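(* For $n\ge 1$ let $\Gamma_n$ be the directed multigraph whose vertices are the isomorphism classes of connected cubic graphs on $2n$ vertices, with one directed edge from $[g]$ to $[w(g)]$ for every edge $\varepsilon$ of $g$ and each of the two Whitehead moves $w=w^{(1)}_\varepsilon, w^{(2)}_\varepsilon$ on $\varepsilon$. Let $A_n$ be the adjacency matrix of $\Gamma_n$ and $\rho_n$ its spectral radius. Then $\rho_n$ is a Perron number, and there is a constant $c_n>0$ such that the number of directed paths of length $\ell$ in $\Gamma_n$ is asymptotic to $c_n\rho_n^\ell$ as $\ell\to\infty$.
   Context: A cubic graph is a finite graph in which every vertex has degree $3$; multiple edges and loops are allowed. Whitehead moves: let $\varepsilon$ be a non-loop edge of a cubic graph $g$ with endpoints $u\neq v$. Besides the half-edge of $\varepsilon$, $u$ carries two half-edges $h_a,h_b$ and $v$ carries two half-edges $h_c,h_d$. The move $w^{(1)}_\varepsilon$ reattaches half-edges so that $u$ carries $h_a,h_c$ and $v$ carries $h_b,h_d$ (with $\varepsilon$ still joining $u,v$); $w^{(2)}_\varepsilon$ makes $u$ carry $h_a,h_d$ and $v$ carry $h_b,h_c$. If $\varepsilon$ is a loop, both moves leave $g$ unchanged (giving loops in $\Gamma_n$). The adjacency matrix has $(A_n)_{uv}$ equal to the number of directed edges from $u$ to $v$ for $u\ne v$, and $(A_n)_{vv}$ equal to the number of loops at $v$. A directed path of length $\ell$ is a sequence of $\ell$ consecutive directed edges (vertices may repeat). A Perron number is an algebraic integer $\rho>1$ all of whose other Galois conjugates have modulus strictly less than $\rho$. *)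

(* Defs.v *)
From HB Require Import structures.
From mathcomp Require Import all_boot all_order all_algebra fingroup perm.
From mathcomp Require Import all_classical all_reals all_analysis.
From mathcomp Require Import complex generic_quotient.

Set Implicit Arguments.
Unset Strict Implicit.
Unset Printing Implicit Defensive.

Import Order.TTheory GRing.Theory Num.Theory numFieldNormedType.Exports.

Local Open Scope ring_scope.
Local Open Scope quotient_scope.

(* A graph is given by its half-edges: [att g h] is the vertex carrying the
   half-edge [h], and [opp g h] is the other half of the edge containing [h].
   This allows loops and multiple edges. A cubic graph on 2n vertices has 6n
   half-edges, so that, up to isomorphism, its vertices and half-edges can be
   taken in 'I_(2 * n) and 'I_(6 * n). *)
Notation vertex n := 'I_(2 * n).
Notation hedge n := 'I_(6 * n).

Definition hgraph (n : nat) : finType :=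
  ({ffun hedge n -> vertex n} * {ffun hedge n -> hedge n})%type.

Section HalfEdgeGraphs.
Variable n : nat.
Implicit Types (g : hgraph n) (u v : vertex n) (h k : hedge n).

Definition att g h : vertex n := g.1 h.
Definition opp g h : hedge n := g.2 h.

Definition star g v : {set hedge n} := [set h | att g h == v].

Definition well_formed g : bool :=
  [forall h, (opp g (opp g h) == h) && (opp g h != h)].

Definition cubic g : bool := [forall v, #|star g v| == 3].

Definition adjacent g u v : bool :=
  [exists h, (att g h == u) && (att g (opp g h) == v)].

Definition connected_graph g : bool :=
  [forall u, forall v, connect (adjacent g) u v].

Definition connected_cubic g : bool := [&& well_formed g, cubic g & connected_graph g].

Definition edges g : {set {set hedge n}} :=
  [set [set h; opp g h] | h : hedge n].

Definition isog g g' : bool :=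
  [exists s : {perm vertex n}, exists t : {perm hedge n}, forall h,
    (att g' (t h) == s (att g h)) && (opp g' (t h) == t (opp g h))].

Definition reattach g u (A : seq (hedge n)) v (B : seq (hedge n)) : hgraph n :=
  ([ffun h => if h \in A then u else if h \in B then v else att g h], g.2).

(* The two Whitehead moves on the edge [e] ([i = false] for the first one,
   [i = true] for the second one). The names of the half-edges are chosen by
   enumeration order; another naming yields the same two moves up to order and
   isomorphism. On an edge of a cubic graph the default cases do not occur. *)
Definition whitehead g (e : {set hedge n}) (i : bool) : hgraph n :=
  if enum e is [:: h; k] then
    let u := att g h in
    let v := att g k in
    if u == v then g else
    match enum (star g u :\ h), enum (star g v :\ k) with
    | [:: a; b], [:: c; d] =>
      if i then reattach g u [:: a; d] v [:: b; c]
      else reattach g u [:: a; c] v [:: b; d]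
    | _, _ => g
    end
  else g.

Lemma isog_refl : reflexive isog.
Proof.
move=> g; apply/existsP; exists 1%g; apply/existsP; exists 1%g.
by apply/forallP => h; rewrite !perm1 !eqxx.
Qed.

Lemma isog_imp g g' : isog g g' -> isog g' g.
Proof.
case/existsP=> s /existsP[t /forallP st].
apply/existsP; exists s^-1%g; apply/existsP; exists t^-1%g.
apply/forallP => h; have /andP[/eqP e1 /eqP e2] := st (t^-1%g h).
rewrite permKV in e1 e2.
by rewrite e1 e2 !permK !eqxx.
Qed.

Lemma isog_sym : symmetric isog.
Proof. by move=> g g'; apply/idP/idP; apply: isog_imp. Qed.

Lemma isog_trans : transitive isog.
Proof.
move=> g2 g1 g3 /existsP[s /existsP[t /forallP st]].
case/existsP=> s' /existsP[t' /forallP st'].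
apply/existsP; exists (s * s')%g; apply/existsP; exists (t * t')%g.
apply/forallP => h; rewrite !permM.
have /andP[/eqP e1 /eqP e2] := st h.
have /andP[/eqP e3 /eqP e4] := st' (t h).
by rewrite e3 e4 e1 e2 !eqxx.
Qed.

Lemma opp_att_in_edges g (e : {set hedge n}) : well_formed g -> e \in edges g ->
  exists h, enum e = [:: h; opp g h].
Proof.
move=> /forallP wf /imsetP[h _ ->].
have /andP[/eqP hK hN] := wf h.
have : size (enum [set h; opp g h]) = 2 by rewrite -cardE cards2 eq_sym hN.
case E: (enum _) => [|x [|y [|]]] // _.
have xE : x \in [set h; opp g h] by rewrite -mem_enum E inE eqxx.
have yE : y \in [set h; opp g h] by rewrite -mem_enum E !inE eqxx orbT.
have : uniq [:: x; y] by rewrite -E enum_uniq.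
rewrite /= inE andbT => xy.
exists x; move: xE yE xy; rewrite !inE.
by case/orP=> /eqP -> /orP[] /eqP ->; rewrite ?eqxx ?hK.
Qed.

Lemma exchange_good g h a b c d (g' := reattach g (att g h) [:: a; c]
    (att g (opp g h)) [:: b; d]) :
    att g h != att g (opp g h) ->
    uniq [:: h; a; b] -> uniq [:: opp g h; c; d] ->
    {subset [:: a; b] <= star g (att g h)} ->
    {subset [:: c; d] <= star g (att g (opp g h))} ->
  connected_cubic g -> connected_cubic g'.
Proof.
set u := att g h; set v := att g (opp g h) => uv.
rewrite /= !inE !negb_or !andbT => /andP[/andP[ha hb] ab] /andP[/andP[kc kd] cd].
move=> sab scd.
have /eqP au : att g a == u by have := sab a; rewrite !inE eqxx; apply.
have /eqP bu : att g b == u by have := sab b; rewrite !inE eqxx orbT; apply.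
have /eqP cv : att g c == v by have := scd c; rewrite !inE eqxx; apply.
have /eqP dv : att g d == v by have := scd d; rewrite !inE eqxx orbT; apply.
have ne x y : att g x = u -> att g y = v -> x != y.
  by move=> xu yv; apply: contraNneq uv => xy; rewrite -xu -yv xy.
have attE x : att g' x = att g (tperm b c x).
  rewrite {1}/att ffunE !inE.
  case: tpermP => [->|->|/eqP xb /eqP xc].
  - by rewrite eqxx (eq_sym b a) (negbTE ab) (negbTE (ne _ _ bu cv)) cv.
  - by rewrite eqxx orbT bu.
  rewrite (negbTE xb) (negbTE xc) orbF /=.
  have [xa|_] := eqVneq x a; first by rewrite xa au.
  by have [xd|_] := eqVneq x d; first by rewrite xd dv.
have oppE x : opp g' x = opp g x by [].
case/and3P=> /forallP wf /forallP cub /forallP con; apply/and3P; split.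
- by apply/forallP => x; rewrite !oppE.
- apply/forallP => w; rewrite -(eqP (cub w)).
  have -> : star g' w = tperm b c @^-1: star g w.
    by apply/setP => x; rewrite !inE attE.
  by rewrite -(card_imset _ (@perm_inj _ (tperm b c))) -im_permV
     -imset_comp (eq_imset _ (g := id)) ?imset_id // => x /=; rewrite permKV.
have csym : connect_sym (adjacent g').
  apply: sym_connect_sym.
  suff H x y : adjacent g' x y -> adjacent g' y x.
    by move=> x y; apply/idP/idP; apply: H.
  case/existsP=> z /andP[/eqP zx /eqP zy]; apply/existsP; exists (opp g z).
  have /andP[/eqP zK _] := wf z.
  by rewrite oppE zK zx -zy !oppE !eqxx.
have hu : att g' h = u.
  have bh : b != h by rewrite eq_sym.
  have ch : c != h by rewrite eq_sym (ne h c).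
  by rewrite attE tpermD.
have kv : att g' (opp g h) = v.
  have bk : b != opp g h by rewrite (ne b (opp g h)).
  have ck : c != opp g h by rewrite eq_sym.
  by rewrite attE tpermD.
have cuv : connect (adjacent g') u v.
  by apply: connect1; apply/existsP; exists h; rewrite oppE hu kv !eqxx.
have catt x : connect (adjacent g') (att g x) (att g' x).
  rewrite attE; case: tpermP => [->|->|_ _]; rewrite ?connect0 // ?bu ?cv //.
  by rewrite csym.
apply/forallP => x; apply/forallP => y; have /forallP/(_ y) := con x.
apply: connect_sub => {}x {}y /existsP[z /andP[/eqP <- /eqP <-]].
apply: connect_trans (catt z) _; rewrite csym.
apply: connect_trans (catt _) _; rewrite csym.
by apply: connect1; apply/existsP; exists z; rewrite oppE !eqxx.
Qed.

Lemma whitehead_good g (e : {set hedge n}) i :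
  e \in edges g -> connected_cubic g -> connected_cubic (whitehead g e i).
Proof.
move=> eg gg; have /and3P[wf /forallP cub _] := gg.
have [h eE] := opp_att_in_edges wf eg; rewrite /whitehead eE.
case: ifPn => // uv.
case Ea: (enum (star g (att g h) :\ h)) => [|a [|b [|]]] //.
case Ec: (enum (star g (att g (opp g h)) :\ opp g h)) => [|c [|d [|]]] //.
have ua : uniq [:: h; a; b].
  by rewrite cons_uniq -Ea enum_uniq mem_enum !inE eqxx.
have uc : uniq [:: opp g h; c; d].
  by rewrite cons_uniq -Ec enum_uniq mem_enum !inE eqxx.
have sa : {subset [:: a; b] <= star g (att g h)}.
  by move=> x; rewrite -Ea mem_enum => /setD1P[].
have sc : {subset [:: c; d] <= star g (att g (opp g h))}.
  by move=> x; rewrite -Ec mem_enum => /setD1P[].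
case: i; apply: exchange_good => //.
  by move: uc; rewrite /= !inE !negb_or (eq_sym d) !andbT
     => /andP[/andP[-> ->] ->].
by move=> x xs; apply: sc; move: xs; rewrite !inE orbC.
Qed.

End HalfEdgeGraphs.

Definition cgraph (n : nat) : finType := {g : hgraph n | connected_cubic g}.

Section IsomorphismClasses.
Variable n : nat.

Definition isoc (g g' : cgraph n) : bool := isog (val g) (val g').

Lemma isoc_refl : reflexive isoc.
Proof. by move=> g; apply: isog_refl. Qed.

Lemma isoc_sym : symmetric isoc.
Proof. by move=> g g'; apply: isog_sym. Qed.

Lemma isoc_trans : transitive isoc.
Proof. by move=> g g' g''; apply: isog_trans. Qed.

Canonical isoc_equiv : equiv_rel (cgraph n) :=
  EquivRel isoc isoc_refl isoc_sym isoc_trans.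

Definition cclass : Type := {eq_quot isoc_equiv}.

HB.instance Definition _ := EqQuotient.on cclass.
HB.instance Definition _ := [Countable of cclass by <:%/].
HB.instance Definition _ :=
  fintype.isFinite.Build cclass (pcan_enumP (can_pcan (@reprK _ cclass))).

End IsomorphismClasses.

Record dmgraph := DMGraph {
  dvert : finType;
  dedge : finType;
  dsrc : dedge -> dvert;
  dtgt : dedge -> dvert }.

Definition adjacency (G : dmgraph) : 'M[nat]_#|dvert G| :=
  \matrix_(i, j)
    #|[set e : dedge G | (dsrc e == enum_val i) && (dtgt e == enum_val j)]|.

Fixpoint dwalk (G : dmgraph) (x : dvert G) (s : seq (dedge G)) : bool :=
  if s is e :: s' then (dsrc e == x) && dwalk (dtgt e) s' else true.

(* A path is recorded together with its starting vertex, so that there is one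
   path of length 0 at each vertex. *)
Definition npaths (G : dmgraph) (l : nat) : nat :=
  #|[set p : dvert G * l.-tuple (dedge G) | dwalk p.1 p.2]|.

Section Gamma.
Variable n : nat.

(* An edge of Gamma_n out of the class c is a pair (edge of a representative
   of c, Whitehead move). An isomorphism between two representatives matches
   their edges and moves, so the multiplicities do not depend on the choice. *)
Definition gamma_edge : finType :=
  {x : cclass n * {set hedge n} * bool | x.1.2 \in edges (val (repr x.1.1))}.

Definition gamma_src (x : gamma_edge) : cclass n := (val x).1.1.

Definition gamma_move (x : gamma_edge) : cgraph n :=
  let g : cgraph n := repr (gamma_src x) in
  exist _ (whitehead (val g) (val x).1.2 (val x).2)
    (whitehead_good (val x).2 (valP x) (valP g)).

Definition gamma_tgt (x : gamma_edge) : cclass n :=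
  \pi_(cclass n) (gamma_move x).

Definition Gamma : dmgraph := DMGraph gamma_src gamma_tgt.

End Gamma.

Section Perron.
Variable R : realType.
Local Notation C := R[i].

Definition spectral_radius (m : nat) (A : 'M[C]_m) : R :=
  sup [set r : R | exists2 z : C, eigenvalue A z & r = complex.Re `|z|].

(* The polynomial p is the minimal polynomial of x over the rationals. *)
Definition galois_conjugate (x y : C) : Prop :=
  exists p : {poly rat}, [/\ p \is monic, irreducible_poly p,
    root (map_poly ratr p) x & root (map_poly ratr p) y].

Definition perron_number (r : R) : Prop :=
  [/\ integralOver (intr : int -> C) (r%:C)%C, 1 < r &
    forall z : C, galois_conjugate (r%:C)%C z -> z != (r%:C)%C ->
      complex.Re `|z| < r].

End Perron.

(* Main.v *)
(* Every vertex of Gamma_n has out-degree 6n: a cubic graph on 2n vertices has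
   3n edges, each carrying two moves. Hence all row sums of A_n equal 6n, so
   that rho_n = 6n, and there are exactly |V| (6n)^l paths of length l; an
   integer is its own only Galois conjugate, and c_n = |V| is positive as soon
   as there is one connected cubic graph on 2n vertices. *)
Require Import Defs.
From mathcomp Require Import all_boot all_order all_algebra.
From mathcomp Require Import all_classical all_reals all_analysis.
From mathcomp Require Import complex.
From mathcomp Require Import generic_quotient zify.

Import Order.TTheory GRing.Theory Num.Theory numFieldNormedType.Exports.
Local Open Scope ring_scope.
Local Open Scope classical_set_scope.

(** * Edges counted through half-edges *)

Lemma card_edges (n : nat) (g : hgraph n) :
  well_formed g -> #|edges g| = (3 * n)%N.
Proof.
move=> /forallP wf; apply/eqP; rewrite -(eqn_pmul2r (isT : (0 < 2)%N)).
have -> : (3 * n * 2 = #|hedge n|)%N by rewrite card_ord; lia.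
(* The half-edges are grouped by the edge containing them. The fibre over an edge is the edge
   itself, and it has two elements because [opp] has no fixed point. *)
rewrite -[X in _ == X]sum1_card (partition_big_imset (fun h => [set h; Defs.opp g h]%SET)) /=.
rewrite -sum_nat_const; apply/eqP; apply: eq_bigr => e /imsetP[h _ ->].
have /andP[/eqP hK hN] := wf h.
have c2 : #|[set h; Defs.opp g h]%SET| = 2%N by rewrite cards2 eq_sym hN.
rewrite -[LHS]c2 -sum1_card; apply: eq_bigl => k; rewrite !inE.
apply/idP/eqP => [/orP[]/eqP-> //|kh]; first by rewrite hK finset.setUC.
by have := set21 k (Defs.opp g k); rewrite kh !inE.
Qed.

(** * Existence of a connected cubic graph on 2n vertices *)

Section RingGraph.
Variable n : nat.
Hypothesis n_gt0 : (0 < n)%N.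

(* The vertex v carries the half-edges 3v, 3v + 1 and 3v + 2; 3v + 2 is glued to
   3v + 3 (cyclically), and the middle half-edges of the vertices 2k and 2k + 1
   are glued together. *)
Definition ring_opp_nat (h : nat) : nat :=
  (if h == 0 then (6 * n).-1 else if h == (6 * n).-1 then 0 else
  match h %% 6 with
  | 1 => h + 3 | 4 => h - 3 | 2 | 5 => h.+1 | _ => h.-1
  end)%N.

Lemma ring_opp_nat_lt h : (h < 6 * n)%N -> (ring_opp_nat h < 6 * n)%N.
Proof.
rewrite /ring_opp_nat => hn; case: eqP => h0; first lia.
case: eqP => h1; first lia.
case E: (h %% 6)%N => [|[|[|[|[|[|m]]]]]]; lia.
Qed.

Lemma ring_opp_natK h : (h < 6 * n)%N -> ring_opp_nat (ring_opp_nat h) = h.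
Proof.
move=> hn; rewrite {2}/ring_opp_nat; case: eqP => h0.
  by rewrite /ring_opp_nat; case: eqP => ?; [lia|rewrite eqxx h0].
case: eqP => h1; first by rewrite /ring_opp_nat eqxx.
(* Away from the pair 0, 6n - 1 the gluing exchanges the residues 0 and 5, 1 and 4, 2 and 3 modulo
   6, and its image avoids that pair; so the second application falls in the same branch of the
   definition. *)
case E: (h %% 6)%N => [|[|[|[|[|[|m]]]]]]; rewrite /ring_opp_nat;
  (case: eqP => ?; first lia); (case: eqP => ?; first lia).
- have -> : (h.-1 %% 6 = 5)%N by lia.
  lia.
- have -> : ((h + 3) %% 6 = 4)%N by lia.
  lia.
- have -> : (h.+1 %% 6 = 3)%N by lia.
  lia.
- have -> : (h.-1 %% 6 = 2)%N by lia.
  lia.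
- have -> : ((h - 3) %% 6 = 1)%N by lia.
  lia.
- have -> : (h.+1 %% 6 = 0)%N by lia.
  lia.
- lia.
Qed.

Lemma ring_opp_nat_neq h : (h < 6 * n)%N -> ring_opp_nat h != h.
Proof.
rewrite /ring_opp_nat => hn; apply/eqP; case: eqP => h0; first lia.
case: eqP => h1; first lia.
case E: (h %% 6)%N => [|[|[|[|[|[|m]]]]]]; lia.
Qed.

Lemma ring_att_lt h : (h < 6 * n)%N -> (h %/ 3 < 2 * n)%N.
Proof. lia. Qed.

Definition ring_graph : hgraph n :=
  ([ffun h : hedge n => Ordinal (ring_att_lt h (ltn_ord h))],
   [ffun h : hedge n => Ordinal (ring_opp_nat_lt h (ltn_ord h))]).

Lemma val_att_ring h : att ring_graph h = (h %/ 3)%N :> nat.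
Proof. by rewrite /att /ring_graph ffunE. Qed.

Lemma val_opp_ring h : Defs.opp ring_graph h = ring_opp_nat h :> nat.
Proof. by rewrite /Defs.opp /ring_graph ffunE. Qed.

Lemma ring_graph_well_formed : well_formed ring_graph.
Proof.
apply/forallP => h; apply/andP; split.
  by apply/eqP/val_inj; rewrite /= !val_opp_ring ring_opp_natK.
by rewrite -val_eqE /= val_opp_ring ring_opp_nat_neq.
Qed.

Lemma ring_graph_cubic : cubic ring_graph.
Proof.
apply/forallP => v.
have lt3 (i : 'I_3) : (3 * v + i < 6 * n)%N.
  by have := ltn_ord v; have := ltn_ord i; lia.
have -> : star ring_graph v = [set Ordinal (lt3 i) | i : 'I_3]%SET.
  apply/setP => h; rewrite inE -val_eqE /= val_att_ring.
  apply/eqP/imsetP => [hv|[i _ ->]] /=; last by have := ltn_ord i; lia.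
  exists (Ordinal (ltn_pmod h (isT : (0 < 3)%N))) => //.
  by apply: val_inj => /=; lia.
rewrite card_imset ?card_ord // => i j [] ij.
by apply: val_inj => /=; lia.
Qed.

(** Adjacency is symmetric, so it is enough to reach every vertex from vertex 0. The half-edge 3k +
    2 is glued to 3k + 3, which gives the step from k to k + 1. *)
Lemma ring_graph_connected : connected_graph ring_graph.
Proof.
have wf := ring_graph_well_formed.
have csym : connect_sym (Defs.adjacent ring_graph).
  apply: sym_connect_sym.
  suff H x y : Defs.adjacent ring_graph x y -> Defs.adjacent ring_graph y x.
    by move=> x y; apply/idP/idP; apply: H.
  case/existsP=> z /andP[zx zy]; apply/existsP; exists (Defs.opp ring_graph z).
  by have /forallP/(_ z)/andP[/eqP-> _] := wf; rewrite zx zy.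
have lt0 : (0 < 2 * n)%N by lia.
suff H k (kn : (k < 2 * n)%N) :
    connect (Defs.adjacent ring_graph) (Ordinal lt0) (Ordinal kn).
  apply/forallP => -[u un]; apply/forallP => -[v vn].
  by apply: connect_trans (H v vn); rewrite csym.
elim: k kn => [|k IHk] kn.
  by rewrite (_ : Ordinal kn = Ordinal lt0) //; apply: val_inj.
apply: connect_trans (IHk (ltnW kn)) _; apply: connect1.
have ltk : (3 * k + 2 < 6 * n)%N by lia.
apply/existsP; exists (Ordinal ltk).
rewrite -!val_eqE /= !val_att_ring val_opp_ring /=.
apply/andP; split; first lia.
apply/eqP; rewrite /ring_opp_nat; case: eqP => ?; first lia.
case: eqP => ?; first lia.
case E: ((3 * k + 2) %% 6)%N => [|[|[|[|[|[|m]]]]]]; lia.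
Qed.

End RingGraph.

Lemma card_Gamma_gt0 (n : nat) : (0 < n)%N -> (0 < #|dvert (Gamma n)|)%N.
Proof.
move=> n_gt0.
have gg : connected_cubic (ring_graph n n_gt0).
  by apply/and3P; split; [exact: ring_graph_well_formed|
    exact: ring_graph_cubic|exact: ring_graph_connected].
by apply/card_gt0P; exists (\pi_(cclass n) (Sub (ring_graph n n_gt0) gg : cgraph n))%qT.
Qed.

(** * Out-degrees, path counts and row sums *)

Definition out_regular (G : dmgraph) (d : nat) : Prop :=
  forall x : dvert G, #|[set e | dsrc e == x]%SET| = d.

Lemma Gamma_out_regular (n : nat) : out_regular (Gamma n) (6 * n).
Proof.
move=> c /=; rewrite -(card_imset _ val_inj) /=.
(* The edges out of [c] are the triples (c, e, b) with [e] one of the 3n edges of the chosen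
   representative and [b] one of the two moves. *)
have -> : [set val x | x in [set e : gamma_edge n | gamma_src e == c]%SET]%SET
    = finset.setX (finset.setX [set c] (edges (val (repr c)))) [set: bool]%SET.
  apply/setP => -[[c' e] b]; rewrite !inE /=.
  apply/imsetP/idP => [[[[[c1 e1] b1] p1]] /=|].
    rewrite inE /gamma_src /= => /eqP cc [-> -> _]; move: p1 => /=.
    by rewrite cc eqxx => ->.
  rewrite andbT => /andP[/eqP-> ee].
  by exists (exist _ (c, e, b) ee) => //; rewrite inE /gamma_src /=.
have /and3P[wf _ _] := valP (repr c).
by rewrite !cardsX cards1 card_edges // cardsT card_bool; lia.
Qed.

(** By induction on [l], there are d ^ l walks from each fixed vertex: a nonempty walk is one of the
    [d] outgoing edges followed by a walk from its target. *)
Lemma npaths_out_regular (G : dmgraph) (d l : nat) :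
  out_regular G d -> npaths G l = (#|dvert G| * d ^ l)%N.
Proof.
move=> Gd.
have H (x : dvert G) : (\sum_(s : l.-tuple (dedge G)) dwalk x s = d ^ l)%N.
  elim: l x => [|l IHl] x.
    rewrite (bigD1 [tuple]) //= big1 // => s /negP[]; exact/eqP/tuple0.
  rewrite (reindex (fun p : dedge G * l.-tuple (dedge G) => cons_tuple p.1 p.2)).
    rewrite -(pair_big xpredT xpredT
      (fun e (s : l.-tuple _) => nat_of_bool (dwalk x (cons_tuple e s)))) /=.
    rewrite expnS -{1}(Gd x) -sum_nat_const big_mkcond [RHS]big_mkcond /=.
    apply: eq_bigr => e _; rewrite inE; case: eqP => _ /=; first exact: IHl.
    by rewrite big1.
  exists (fun t => (thead t, behead_tuple t)) => [[e s] _|t _].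
    by congr pair => //; apply: val_inj.
  by case/tupleP: t => e s; apply: val_inj.
have -> : npaths G l =
    (\sum_(p : dvert G * l.-tuple (dedge G)) dwalk p.1 p.2)%N.
  rewrite /npaths -sum1_card big_mkcond /=.
  by apply: eq_bigr => p _; rewrite inE; case: ifP.
rewrite -(pair_big xpredT xpredT
  (fun x (s : l.-tuple _) => nat_of_bool (dwalk x s))) /=.
by rewrite (eq_bigr (fun=> d ^ l)%N) // sum_nat_const.
Qed.

(** The edges leaving a vertex are partitioned by their targets. *)
Lemma adjacency_row_sum (G : dmgraph) (d : nat) i :
  out_regular G d -> (\sum_j adjacency G i j = d)%N.
Proof.
move=> Gd; rewrite -(Gd (enum_val i)) -sum1_card.
rewrite (partition_big (fun e => enum_rank (dtgt e)) xpredT) //=.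
apply: eq_bigr => j _; rewrite mxE -sum1_card; apply: eq_bigl => e.
by rewrite !inE -(can_eq enum_valK) !enum_rankK.
Qed.

(** * Spectral radius for constant row sums, and integers as Perron numbers *)

Section SpectralRadius.
Variable R : realType.

Lemma spectral_radius_row_sum (m : nat) (A : 'M[R[i]]_m) (d : R) :
  (0 < m)%N -> (forall i j, 0 <= A i j) ->
  (forall i, \sum_j A i j = (d%:C)%C) -> spectral_radius A = d.
Proof.
move=> m_gt0 A_ge0 rowA.
have d_ge0 : 0 <= d.
  by rewrite -lecR -(rowA (Ordinal m_gt0)) sumr_ge0.
(* [eigenvalue] refers to row vectors, whereas constant row sums make the all-ones column a right
   eigenvector. That column is killed by A - d, which is therefore singular. *)
have eigd : eigenvalue A (d%:C)%C.
  rewrite /eigenvalue kermx_eq0 row_free_unit; apply/negP => Au.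
  have : (A - (d%:C)%C%:M) *m const_mx 1 = 0 :> 'cV_m.
    apply/matrixP => i j; rewrite mulmxBl mul_scalar_mx !mxE mulr1 -(rowA i).
    by apply/eqP; rewrite subr_eq0; apply/eqP/eq_bigr => k _; rewrite mxE mulr1.
  move/(congr1 (mulmx (invmx (A - (d%:C)%C%:M)))).
  rewrite mulKmx // mulmx0 => /matrixP/(_ (Ordinal m_gt0) ord0)/eqP.
  by rewrite !mxE oner_eq0.
(* The l1 norm of a left eigenvector [v] is compared on both sides of vA = zv: the triangle
   inequality and the row sums bound the norm of vA by [d] times that of [v]. *)
have eig_le z : eigenvalue A z -> `|z| <= (d%:C)%C.
  case/eigenvalueP => v vA v_neq0.
  have S_gt0 : 0 < \sum_j `|v 0 j|.
    rewrite lt_def sumr_ge0 // andbT; apply: contra v_neq0 => /eqP S0.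
    apply/eqP/rowP => j; rewrite mxE; apply/eqP; rewrite -normr_eq0.
    by apply/eqP/(psumr_eq0P _ S0).
  rewrite -(ler_pM2r S_gt0) mulr_sumr.
  have -> : \sum_j `|z| * `|v 0 j| = \sum_j `|\sum_i v 0 i * A i j|.
    apply: eq_bigr => j _; rewrite -normrM; congr `|_|.
    by have /rowP/(_ j) := vA; rewrite !mxE.
  have -> : (d%:C)%C * \sum_j `|v 0 j| = \sum_j \sum_i `|v 0 i * A i j|.
    rewrite exchange_big mulr_sumr; apply: eq_bigr => i _.
    rewrite -(rowA i) mulr_suml; apply: eq_bigr => j _.
    by rewrite normrM (ger0_norm (A_ge0 _ _)) mulrC.
  by apply: ler_sum => j _; apply: ler_norm_sum.
have ubd : ubound [set r : R | exists2 z, eigenvalue A z & r = complex.Re `|z|] d.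
  by move=> r [z /eig_le zd ->]; move: zd; rewrite lecE => /andP[].
have memd : [set r : R | exists2 z, eigenvalue A z & r = complex.Re `|z|] d.
  by exists (d%:C)%C; rewrite // ger0_norm // lecR.
apply/eqP; rewrite eq_le; apply/andP; split.
  by apply: ge_sup => //; exists d.
by apply: ub_le_sup => //; exists d.
Qed.

(** An irreducible rational polynomial vanishing at [k] is divisible by X - k, hence associated to
    it. Its only root is [k], so the condition on the other conjugates is vacuous. *)
Lemma perron_number_nat (k : nat) : (1 < k)%N -> perron_number (k%:R : R).
Proof.
move=> k_gt1; split; [|by rewrite ltr1n|].
  rewrite rmorph_nat; exact: integral_nat.
move=> z [p [_ [_ p_irr]]]; rewrite rmorph_nat -(ratr_nat _ k) fmorph_root.
rewrite -dvdp_XsubCl => /p_irr; rewrite size_XsubC => /(_ isT) pX.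
move=> pz /negP[]; move: pz.
rewrite -(eqp_root (_ : map_poly ratr ('X - k%:R%:P) %= _)).
  by rewrite map_polyXsubC /= ratr_nat root_XsubC.
by rewrite eqp_map.
Qed.

End SpectralRadius.

Theorem theorem4p1 (R : realType) (n : nat) (n_gt0 : (0 < n)%N) :
  let A : 'M[R[i]]_#|dvert (Gamma n)| :=
    map_mx (fun k : nat => k%:R) (adjacency (Gamma n)) in
  let rho : R := spectral_radius A in
  perron_number rho /\
  exists2 c : R, 0 < c &
    (fun l : nat => (npaths (Gamma n) l)%:R : R) ~_\oo
    (fun l : nat => c * rho ^+ l).
Proof.
move=> A rho; have V_gt0 := card_Gamma_gt0 n n_gt0.
have Gd := Gamma_out_regular n.
have rhoE : rho = (6 * n)%:R.
  apply: spectral_radius_row_sum => // [i j|i]; first by rewrite mxE ler0n.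
  rewrite rmorph_nat -(adjacency_row_sum _ _ i Gd) natr_sum.
  by apply: eq_bigr => j _; rewrite mxE.
split; first by rewrite rhoE; apply: perron_number_nat; lia.
exists #|dvert (Gamma n)|%:R; first by rewrite ltr0n.
(* The two sequences agree for every [l], not only asymptotically. *)
have -> : (fun l => (npaths (Gamma n) l)%:R : R) =
    (fun l => #|dvert (Gamma n)|%:R * rho ^+ l).
  by apply/funext => l; rewrite (npaths_out_regular _ _ _ Gd) rhoE natrM natrX.
exact: landau.equiv_refl.
Qed.
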